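(* Let $R$ be a ring and $\mathcal{A}\subseteq \mathrm{Spec}(R)$. The following conditions are equivalent: (1) $\mathcal{A}$ is compact and has the P.A-property for all finitely generated ideals of $R$. (2) $\mathcal{A}$ has the P.A-property for $R$.
   Context: All rings are commutative with $1\neq 0$. For $\mathcal{A}\subseteq \mathrm{Spec}(R)$ and a family $\mathcal{S}$ of subsets of $R$, $\mathcal{A}$ has the P.A-property (prime avoidance property) for $\mathcal{S}$ if whenever $S\in\mathcal{S}$ and $S\subseteq\bigcup_{P\in\mathcal{A}}P$, there exists $P\in\mathcal{A}$ with $S\subseteq P$. It has the P.A-property (for $R$) if this holds with $\mathcal{S}$ the family of all ideals of $R$; it has the P.A-property for all finitely generated ideals if this holds with $\mathcal{S}$ the family of all finitely generated ideals of $R$. The set $\mathcal{A}$ carries the Zariski (hull-kernel) topology, whose closed sets are the sets $V_{\mathcal{A}}(I)=\{P\in\mathcal{A}\mid I\subseteq P\}$ for ideals $I$ of $R$ (i.e. the subspace topology from $\mathrm{Spec}(R)$). Compact means that every open cover has a finite subcover (no Hausdorff condition). *)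

(* Defs.v *)
From HB Require Import structures.
From mathcomp Require Import all_boot all_order all_algebra.
From mathcomp Require Import all_classical.
From mathcomp Require Import topology_structure compact initial_topology.
From mathcomp Require Import subspace_topology subtype_topology.

Set Implicit Arguments.
Unset Strict Implicit.
Unset Printing Implicit Defensive.

Import GRing.Theory.

Local Open Scope classical_set_scope.
Local Open Scope ring_scope.

(* Unlike ring_quotient.idealr, this allows the unit ideal. *)
Definition is_ideal (R : comNzRingType) (I : set R) : Prop :=
  [/\ I 0,
      forall x y, I x -> I y -> I (x + y) &
      forall a x, I x -> I (a * x)].

Definition is_fg_ideal (R : comNzRingType) (I : set R) : Prop :=
  exists2 X : set R, finite_set X & I = smallest (@is_ideal R) X.

Definition spec (R : comNzRingType) : Type := prime_idealr R.

Definition prime_set (R : comNzRingType) (P : spec R) : set R :=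
  [set x | x \in (P : prime_idealr R)].

Definition hull (R : comNzRingType) (I : set R) : set (spec R) :=
  [set P | I `<=` prime_set P].

Definition zariski_open (R : comNzRingType) (U : set (spec R)) : Prop :=
  exists2 I : set R, is_ideal I & U = ~` hull I.

Lemma prime_set_inj (R : comNzRingType) : injective (@prime_set R).
Proof.
move=> [p cp] [q cq] /= /seteqP[pq qp].
have e : p = q.
  by apply/funext => x; apply/idP/idP => [/pq|/qp].
move=> {pq qp}; subst q; congr (PrimeIdealr.Pack _).
case: cp cq => [[a1] [a2] [a3] [a4]] [[b1] [b2] [b3] [b4]].
by rewrite (Prop_irrelevance a1 b1) (Prop_irrelevance a2 b2)
  (Prop_irrelevance a3 b3) (Prop_irrelevance a4 b4).
Qed.

Section PrimeSet.
Variables (R : comNzRingType) (P : spec R).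

Lemma prime_set_ideal : is_ideal (prime_set P).
Proof.
split=> [|x y|a x]; rewrite /prime_set /=; first exact: idealr0.
  exact: rpredD.
exact: idealMr.
Qed.

Lemma prime_set1 : ~ prime_set P 1.
Proof. by rewrite /prime_set /= idealr1. Qed.

Lemma prime_setM x y : prime_set P (x * y) -> prime_set P x \/ prime_set P y.
Proof. by rewrite /prime_set /= prime_idealrM => /orP. Qed.

End PrimeSet.

Section Zariski.
Variable R : comNzRingType.
Implicit Types I J : set R.

Lemma is_ideal_bigcap (F : set (set R)) :
  (forall I, F I -> is_ideal I) -> is_ideal (\bigcap_(I in F) I).
Proof.
move=> FI; split=> [I /FI[]//|x y xF yF I IF|a x xF I IF].
  by have [_ + _] := FI I IF; apply; [exact: xF|exact: yF].
by have [_ _] := FI I IF; apply; exact: xF.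
Qed.

Lemma is_ideal_smallest (X : set R) : is_ideal (smallest (@is_ideal R) X).
Proof. by apply: is_ideal_bigcap => I []. Qed.

Lemma zariski_openT : zariski_open [set: spec R].
Proof.
exists setT => //; apply/seteqP; split=> // P _ /(_ 1 Logic.I).
exact: prime_set1.
Qed.

Lemma zariski_openI : setI_closed (@zariski_open R).
Proof.
move=> _ _ [I idI ->] [J idJ ->]; have [I0 ID IM] := idI; have [J0 JD JM] := idJ.
exists (I `&` J).
  split=> [//|x y [? ?] [? ?]|a x [? ?]]; first by split; [exact: ID|exact: JD].
  by split; [exact: IM|exact: JM].
rewrite -setCU; congr (~` _); apply/seteqP; split=> P.
  by move=> [IP|JP] x [Ix Jx]; [exact: IP|exact: JP].
move=> IJP; apply: contrapT => /not_orP[] /existsNP[x /not_implyP[Ix Px]].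
move=> /existsNP[y /not_implyP[Jy Py]].
have : prime_set P (x * y) by apply: IJP; split; [rewrite mulrC; exact: IM|exact: JM].
by move=> /prime_setM[].
Qed.

Lemma zariski_open_bigU (T : Type) (f : T -> set (spec R)) :
  (forall t, zariski_open (f t)) -> zariski_open (\bigcup_t f t).
Proof.
move=> /(_ _)/cid2 => fo.
pose I t := s2val (fo t).
exists (smallest (@is_ideal R) (\bigcup_t I t)); first exact: is_ideal_smallest.
apply/seteqP; split=> P.
  move=> [t _]; rewrite (s2valP' (fo t)) => nIP sP; apply: nIP => x Ix.
  by apply: sP; apply: sub_gen_smallest; exists t.
move=> nP; apply: contrapT => nU; apply: nP; apply: smallest_sub.
  exact: prime_set_ideal.
move=> x [t _ Ix]; apply: contrapT => Px; apply: nU; exists t => //.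
by rewrite (s2valP' (fo t)) => /(_ _ Ix).
Qed.

HB.instance Definition _ := gen_eqMixin (spec R).
HB.instance Definition _ := gen_choiceMixin (spec R).
HB.instance Definition _ := isOpenTopological.Build (spec R)
  zariski_openT zariski_openI zariski_open_bigU.

Lemma open_specE : open = @zariski_open R. Proof. by []. Qed.

Lemma closed_specP (C : set (spec R)) :
  closed C <-> exists2 I, is_ideal I & C = hull I.
Proof.
rewrite -openC open_specE; split=> [[I idI CI]|[I idI ->]]; last by exists I.
by exists I => //; rewrite -[C]setCK CI setCK.
Qed.

(* A set A : set (spec R), used as a type, carries the subspace topology. *)
Lemma closed_subspecP (A : set (spec R)) (C : set A) :
  closed C <->
  exists2 I : set R, is_ideal I & C = [set P | I `<=` prime_set (set_val P)].
Proof.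
rewrite -openC; split=> [[_ [I idI ->] CI]|[I idI ->]].
  by exists I => //; rewrite -[C]setCK -CI preimage_setC setCK.
by exists (~` hull I); first by exists I.
Qed.

End Zariski.

Definition PA_property_for (R : comNzRingType) (A : set (spec R))
    (S : set (set R)) : Prop :=
  forall E : set R, S E -> E `<=` \bigcup_(P in A) prime_set P ->
    exists2 P, A P & E `<=` prime_set P.

Definition PA_property (R : comNzRingType) (A : set (spec R)) : Prop :=
  PA_property_for A (@is_ideal R).

(* Main.v *)
Require Import Defs.
From mathcomp Require Import all_boot all_algebra all_classical.
From mathcomp Require Import topology_structure compact subtype_topology.
From mathcomp Require Import finmap.

Local Open Scope classical_set_scope.

(** Both implications match open covers of [A] with ideals.

    If an ideal [E] lies in no member of [A], then the basic open sets
    [D(x)], for [x] in [E], cover [A].  Compactness leaves finitely many [x],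
    and the ideal they generate is still contained in [E] and in no member of
    [A]; avoidance for finitely generated ideals then says that it is not
    covered by [A], so [E] is not either ([PA_property_of_fg]).

    Conversely, let [f] be an open cover of [A], and consider the set of those
    [x] for which the trace of [D(x)] on [A] is covered by finitely many [f i]
    ([finitely_covered]).  It is an ideal, and it lies in no member [P] of [A]:
    if [P] is in the open set [f i], then some basic neighbourhood [D(y)] of
    [P] is inside [f i], so [y] is in the ideal but not in [P].  By prime
    avoidance this ideal has an element outside every member of [A]; its
    [D(x)] contains [A], so a finite subcover exists ([PA_property_compact]). *)

Lemma open_basic (R : comNzRingType) (x : R) :
  open [set P : spec R | ~ prime_set P x].
Proof.
rewrite open_specE; exists (smallest (@is_ideal R) [set x]).
  exact: is_ideal_smallest.
apply/seteqP; split=> P /= Px.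
  by move=> IP; apply: Px; apply: IP; exact: sub_gen_smallest.
move=> xP; apply: Px; apply: smallest_sub; first exact: prime_set_ideal.
by move=> _ ->.
Qed.

Lemma open_basic_nbhs (R : comNzRingType) (U : set (spec R)) (P : spec R) :
  open U -> U P ->
  exists2 y : R, ~ prime_set P y & [set Q | ~ prime_set Q y] `<=` U.
Proof.
rewrite open_specE => -[I _ ->] /existsNP[y /not_implyP[Iy Py]].
by exists y => // Q Qy IQ; apply: Qy; exact: IQ.
Qed.

Lemma is_ideal_fg (R : comNzRingType) (E : set R) : is_fg_ideal E -> is_ideal E.
Proof. by move=> [X _ ->]; exact: is_ideal_smallest. Qed.

Lemma PA_property_of_fg (R : comNzRingType) (A : set (spec R)) :
  cover_compact [set: set_type A] -> PA_property_for A (@is_fg_ideal R) ->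
  PA_property A.
Proof.
move=> Ac Afg E idE EA; apply: contrapT => nE.
pose f (x : R) : set (set_type A) := [set P | ~ prime_set (set_val P) x].
have fo x : E x -> open (f x).
  by move=> _; exists [set P | ~ prime_set P x]; [exact: open_basic|].
have fcov : [set: set_type A] `<=` cover E f.
  move=> P _; apply: contrapT => nP; apply: nE.
  exists (set_val P); first exact: set_valP.
  by move=> x Ex; apply: contrapT => Px; apply: nP; exists x.
have [X XE Xcov] := Ac _ E f fo fcov.
have XsE : smallest (@is_ideal R) [set` X] `<=` E.
  by apply: smallest_sub => // x /XE /set_mem.
have [||P AP XP] := Afg (smallest (@is_ideal R) [set` X]).
- by exists [set` X].
- exact: subset_trans XsE EA.
have [x xX Px] := Xcov (SigSub (mem_set AP)) I.
by apply: Px; apply: XP; exact: sub_gen_smallest.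
Qed.

Definition finitely_covered {R : comNzRingType} {A : set (spec R)}
    {J : choiceType} (D : set J) (f : J -> set (set_type A)) : set R :=
  [set x | exists2 D' : {fset J}, {subset D' <= D} &
    [set P | ~ prime_set (set_val P) x] `<=` cover [set` D'] f].

(** The closure properties come from those of basic open sets:
    [D(0) = set0], [D(x + y) `<=` D(x) `|` D(y)] and [D(a * x) `<=` D(x)]. *)
Lemma is_ideal_finitely_covered (R : comNzRingType) (A : set (spec R))
    (J : choiceType) (D : set J) (f : J -> set (set_type A)) :
  is_ideal (finitely_covered D f).
Proof.
split=> [|x y [X XD Xx] [Y YD Yy]|a x [X XD Xx]].
- exists fset0 => // P /= P0.
  by have [] := prime_set_ideal (set_val P).
- exists (X `|` Y)%fset.
    by move=> i; rewrite in_fsetU => /orP[/XD|/YD].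
  move=> P /= Pxy.
  have [Px|/Xx[i iX fi]] := pselect (prime_set (set_val P) x); last first.
    by exists i => //=; rewrite in_fsetU iX.
  have [Py|/Yy[i iY fi]] := pselect (prime_set (set_val P) y); last first.
    by exists i => //=; rewrite in_fsetU iY orbT.
  by have [_ PD _] := prime_set_ideal (set_val P); case: Pxy; exact: PD.
- exists X => // P /= Pax; apply: Xx => Px; apply: Pax.
  by have [_ _ PM] := prime_set_ideal (set_val P); exact: PM.
Qed.

Lemma PA_property_compact (R : comNzRingType) (A : set (spec R)) :
  PA_property A -> cover_compact [set: set_type A].
Proof.
move=> PA J D f fo fcov.
apply: contrapT => nfin.
have [|P AP IP] := PA _ (is_ideal_finitely_covered _ A _ D f).
  move=> x [D' D'D D'x]; apply: contrapT => xA; apply: nfin.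
  exists D' => // P _; apply: D'x => Px; apply: xA.
  by exists (set_val P); [exact: set_valP|].
have [i Di fiP] := fcov (SigSub (mem_set AP)) I.
have [U oU UE] := fo i Di.
have UP : U P by move: fiP; rewrite -UE.
have [y Py yU] := open_basic_nbhs _ _ _ oU UP.
apply: Py; apply: IP; exists [fset i]%fset.
  by move=> j; rewrite in_fset1 => /eqP ->; exact: mem_set.
move=> Q /yU UQ; exists i; first by rewrite /= in_fset1.
by rewrite -UE.
Qed.

Theorem theorem2p5 (R : comNzRingType) (A : set (spec R)) :
  (cover_compact [set: set_type A] /\ PA_property_for A (@is_fg_ideal R))
  <-> PA_property A.
Proof.
split=> [[Ac Afg]|PA]; first exact: PA_property_of_fg.
split; first exact: PA_property_compact.
by move=> E /is_ideal_fg; exact: PA.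
Qed.
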